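(* Let $\mathcal{H}_N$, $\mathcal{H}_S$, $\mathcal{H}_T$ be finite-dimensional Hilbert spaces, let $\Phi=\Phi_{NS}$ be a density operator on $\mathcal{H}_N\otimes\mathcal{H}_S$ and $\Psi=\Psi_{NT}$ a density operator on $\mathcal{H}_N\otimes\mathcal{H}_T$. Then $\Phi$ is better than $\Psi$ (in the sense defined in the context) if and only if there exists a completely positive trace-preserving linear map $\mathcal{E}$ from operators on $\mathcal{H}_S$ to operators on $\mathcal{H}_T$ such that \[\Psi_{NT}=(\mathcal{I}_N\otimes\mathcal{E})\Phi_{NS},\] where $\mathcal{I}_N$ is the identity map on operators over $\mathcal{H}_N$.
   Context: An information structure is a triple $(\mathcal{H}_N,\mathcal{H}_S,\Phi_{NS})$ with $\mathcal{H}_N,\mathcal{H}_S$ finite-dimensional Hilbert spaces and $\Phi_{NS}$ a density operator on $\mathcal{H}_N\otimes\mathcal{H}_S$; the observer has access to $S$. A game is a tuple $(\mathcal{H}_A,\mathcal{H}_B,\rho_{AB},M^1,\dots,M^k)$ where $\mathcal{H}_A,\mathcal{H}_B$ are finite-dimensional Hilbert spaces (the environment), $\rho_{AB}$ is a density operator on $\mathcal{H}_A\otimes\mathcal{H}_B$, $k\ge 1$, and each $M^i$ is a Hermitian operator on $\mathcal{H}_N\otimes\mathcal{H}_B$. A strategy is a POVM $(D^1,\dots,D^k)$ on $\mathcal{H}_S\otimes\mathcal{H}_A$, i.e. positive semidefinite operators with $D^1+\dots+D^k=I$. The optimal payoff is \[R(\Phi_{NS};\rho_{AB},M^1,\dots,M^k)=\max_{(D^1,\dots,D^k)}\sum_{i=1}^k\operatorname{tr}\bigl((\Phi_{NS}\otimes\rho_{AB})(M^i_{NB}\otimes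 D^i_{SA})\bigr),\] the maximum over all strategies (tensor factors reordered appropriately). For information structures $\Phi_{NS}$ on $\mathcal{H}_N\otimes\mathcal{H}_S$ and $\Psi_{NT}$ on $\mathcal{H}_N\otimes\mathcal{H}_T$ (same $\mathcal{H}_N$), $\Phi$ is said to be better than $\Psi$ if for every finite-dimensional $\mathcal{H}_A,\mathcal{H}_B$, every density operator $\rho_{AB}$, every $k$ and every Hermitian $M^1,\dots,M^k$ on $\mathcal{H}_N\otimes\mathcal{H}_B$, one has $R(\Phi_{NS};\rho_{AB},M^1,\dots,M^k)\ge R(\Psi_{NT};\rho_{AB},M^1,\dots,M^k)$. *)

(* Defs.v *)
From HB Require Import structures.
From mathcomp Require Import all_boot all_order all_algebra.
From mathcomp Require Import all_classical all_reals.
From mathcomp Require Import complex mxtens.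

Set Implicit Arguments.
Unset Strict Implicit.
Unset Printing Implicit Defensive.

Import Order.TTheory GRing.Theory Num.Theory.
Local Open Scope ring_scope.
Local Open Scope classical_set_scope.

(* Throughout, R : realType is the field of real numbers and R[i] = C the
   complex numbers.  A d-dimensional Hilbert space is C^d; operators on it are
   'M[R[i]]_d.  The tensor product H_m (x) H_n is C^(m*n), with the Kronecker
   indexing convention of mxtens: (i,j) |-> mxtens_index (i,j) = i*n + j, so
   that (A *t B) (i,j) (k,l) = A i k * B j l. *)

Section Quantum.
Variable R : realType.
Local Notation C := (R[i]).

Definition adjmx m n (A : 'M[C]_(m, n)) : 'M[C]_(n, m) := (map_mx Num.conj A)^T.

Definition psdmx n (A : 'M[C]_n) : Prop :=
  adjmx A = A /\ forall v : 'rV[C]_n, 0 <= (v *m A *m adjmx v) 0 0.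

Definition hermitianmx n (A : 'M[C]_n) : Prop := adjmx A = A.

Definition density n (A : 'M[C]_n) : Prop := psdmx A /\ \tr A = 1.

Definition blockmx k n (X : 'M[C]_(k * n)) (a a' : 'I_k) : 'M[C]_n :=
  \matrix_(s, s') X (mxtens_index (a, s)) (mxtens_index (a', s')).

Definition id_tens k n p (E : 'M[C]_n -> 'M[C]_p) (X : 'M[C]_(k * n))
  : 'M[C]_(k * p) :=
  \matrix_(i, j)
    E (blockmx X (mxtens_unindex i).1 (mxtens_unindex j).1)
      (mxtens_unindex i).2 (mxtens_unindex j).2.

Definition completely_positive n p (E : 'M[C]_n -> 'M[C]_p) : Prop :=
  forall (k : nat) (X : 'M[C]_(k * n)), psdmx X -> psdmx (id_tens E X).

Definition trace_preserving n p (E : 'M[C]_n -> 'M[C]_p) : Prop :=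
  forall X : 'M[C]_n, \tr (E X) = \tr X.

Definition idx4 nN nS nA nB (i : 'I_((nN * nS) * (nA * nB))) :=
  let: (x, y) := mxtens_unindex i in
  (mxtens_unindex x, mxtens_unindex y).

(* The operator M_NB (x) D_SA, with tensor factors reordered to act on
   H_N (x) H_S (x) H_A (x) H_B (grouped as (N S)(A B)). *)
Definition reorder_tens nN nS nA nB (M : 'M[C]_(nN * nB)) (D : 'M[C]_(nS * nA))
  : 'M[C]_((nN * nS) * (nA * nB)) :=
  \matrix_(i, j)
    let: ((n, s), (a, b)) := idx4 i in
    let: ((n', s'), (a', b')) := idx4 j in
    M (mxtens_index (n, b)) (mxtens_index (n', b'))
    * D (mxtens_index (s, a)) (mxtens_index (s', a')).

Definition strategy nS nA k (D : 'I_k -> 'M[C]_(nS * nA)) : Prop :=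
  (forall i, psdmx (D i)) /\ \sum_(i < k) D i = 1%:M.

Definition payoff nN nS nA nB k (Phi : 'M[C]_(nN * nS)) (rho : 'M[C]_(nA * nB))
  (M : 'I_k -> 'M[C]_(nN * nB)) (D : 'I_k -> 'M[C]_(nS * nA)) : C :=
  \sum_(i < k) \tr ((Phi *t rho) *m reorder_tens (M i) (D i)).

(* Optimal payoff R(Phi; rho, M^1..M^k): the maximum over all strategies
   (the payoff is real; the maximum is attained, so it equals the sup). *)
Definition opt_payoff nN nS nA nB k (Phi : 'M[C]_(nN * nS))
  (rho : 'M[C]_(nA * nB)) (M : 'I_k -> 'M[C]_(nN * nB)) : R :=
  sup [set complex.Re (payoff Phi rho M D) | D in
        [set D : 'I_k -> 'M[C]_(nS * nA) | strategy D]].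

Definition better nN nS nT (Phi : 'M[C]_(nN * nS)) (Psi : 'M[C]_(nN * nT))
  : Prop :=
  forall (nA nB : nat) (rho : 'M[C]_(nA * nB)) (k : nat)
         (M : 'I_k -> 'M[C]_(nN * nB)),
    density rho -> (0 < k)%N -> (forall i, hermitianmx (M i)) ->
    opt_payoff Psi rho M <= opt_payoff Phi rho M.

End Quantum.

(* Main.v *)
(** A channel S -> T is encoded by its Choi matrix G, and [link Phi G] is the
    structure obtained by applying it to the observer's part of Phi.

    If Psi = [link Phi G], any strategy for Psi is pulled back along G to a
    strategy for Phi with the same payoff, because the payoff depends on
    (Phi, D) only through [link Phi D^T], and [link] is associative.

    Conversely, the Choi matrices form a compact convex set, so some G minimises
    the Hilbert-Schmidt distance from [link Phi G] to Psi.  Put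
    W = Psi - [link Phi G]; then tr(W [link Phi G']) <= tr(W [link Phi G]) for all
    channels G'.  Take for A, B two copies of T in the maximally entangled state
    and payoffs M_i = (1 (x) U_i) W (1 (x) U_i)^T, where the orthogonal matrices
    U_i satisfy sum_i U_i X U_i^T = const * tr(X) * 1.  A strategy for this game
    is a teleportation protocol: the payoff of D is tr(W [link Phi (twirl U D)]) with
    [twirl U D] a channel, while the observer holding Psi can teleport perfectly
    and get tr(W Psi).  So "better" gives tr(W Psi) <= tr(W [link Phi G]), that is
    tr(W^2) <= 0, and W = 0. *)

Require Import Defs.
From HB Require Import structures.
From mathcomp Require Import all_boot all_order all_algebra.
From mathcomp Require Import all_classical all_reals.
From mathcomp Require Import complex mxtens.
From mathcomp Require Import spectral ring lra.
From mathcomp Require Import topology normedtype derive.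

Import Order.TTheory GRing.Theory Num.Theory.
Import numFieldNormedType.Exports.
Local Open Scope ring_scope.

(** * Positive semidefinite matrices: Gram factorisations and entry bounds *)

Section PositiveMatrices.
Context {R : realType}.
Local Notation C := R[i].

Lemma adjmxE m n (A : 'M[C]_(m, n)) i j : adjmx A i j = (A j i)^*.
Proof. by rewrite /adjmx !mxE. Qed.

Lemma adjmxK m n (A : 'M[C]_(m, n)) : adjmx (adjmx A) = A.
Proof. by apply/matrixP => i j; rewrite !adjmxE conjCK. Qed.

Lemma adjmx_mul m n p (A : 'M[C]_(m, n)) (B : 'M[C]_(n, p)) :
  adjmx (A *m B) = adjmx B *m adjmx A.
Proof. by rewrite /adjmx map_mxM trmx_mul. Qed.

Lemma adjmxD m n (A B : 'M[C]_(m, n)) : adjmx (A + B) = adjmx A + adjmx B.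
Proof. by rewrite /adjmx map_mxD raddfD. Qed.

Lemma psdmx_gram m n (K : 'M[C]_(m, n)) : psdmx (adjmx K *m K).
Proof.
split; first by rewrite adjmx_mul adjmxK.
move=> v; rewrite mulmxA -(mulmxA (v *m _)).
have -> : K *m adjmx v = adjmx (v *m adjmx K) by rewrite adjmx_mul adjmxK.
rewrite mxE; apply: sumr_ge0 => i _; rewrite adjmxE.
exact: mul_conjC_ge0.
Qed.

(** By the spectral theorem [A] is [adjmx P *m diag_mx d *m P] with [P] unitary; the factor is the
    square root of the diagonal part times [P]. *)
Lemma psdmx_gramP {n} {A : 'M[C]_n} :
  psdmx A -> exists K : 'M[C]_n, A = adjmx K *m K.
Proof.
case=> hA pA.
have adjE m p (B : 'M[C]_(m, p)) : map_mx Num.conj B^T = adjmx B.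
  by rewrite /adjmx map_trmx.
have nA : A \is normalmx.
  by apply/normalmxP; rewrite adjE hA.
have := orthomx_spectralP nA.
set P := spectralmx A; set d := spectral_diag A.
have uP : P \is unitarymx by exact: spectral_unitarymx.
have /unitarymxP PP := uP.
rewrite (invmx_unitary uP) !adjE in PP * => eA.
have d_ge0 i : 0 <= d 0 i.
  (* Testing positivity on the [i]-th row of [P] isolates the [i]-th eigenvalue. *)
  have := pA (row i P); rewrite eA.
  have -> : row i P *m (adjmx P *m diag_mx d *m P) *m adjmx (row i P)
      = row i (P *m adjmx P) *m diag_mx d *m adjmx (row i (P *m adjmx P)).
    by rewrite !row_mul adjmx_mul adjmxK !mulmxA.
  rewrite PP mxE (bigD1 i) //= big1 ?addr0.
    rewrite mul_mx_diag adjmxE !mxE eqxx mul1r.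
    by rewrite conjC1 mulr1.
  move=> j ji; rewrite adjmxE !mxE eq_sym (negPf ji) conjC0.
  by rewrite mulr0.
exists (diag_mx (map_mx sqrtC d) *m P).
rewrite adjmx_mul mulmxA -(mulmxA (adjmx P)) {1}eA.
congr (_ *m _ *m _); apply/matrixP => i j.
rewrite mul_mx_diag mxE adjmxE !mxE eq_sym.
case: eqVneq => [->|ji]; last by rewrite !mulr0n conjC0 mul0r.
rewrite !mulr1n conj_Creal; last by apply: ger0_real; rewrite sqrtC_ge0.
by rewrite -expr2 sqrtCK.
Qed.

Lemma psdmxD n (A B : 'M[C]_n) : psdmx A -> psdmx B -> psdmx (A + B).
Proof.
move=> [hA pA] [hB pB]; split; first by rewrite adjmxD hA hB.
by move=> v; rewrite mulmxDr mulmxDl mxE addr_ge0.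
Qed.

Lemma psdmx0 n : psdmx (0 : 'M[C]_n).
Proof.
split; first by apply/matrixP => i j; rewrite adjmxE !mxE conjC0.
by move=> v; rewrite mulmx0 mul0mx mxE.
Qed.

Lemma psdmxZ n (a : C) (A : 'M[C]_n) : 0 <= a -> psdmx A -> psdmx (a *: A).
Proof.
move=> a0 [hA pA]; split.
  apply/matrixP => i j; rewrite adjmxE !mxE rmorphM /= -adjmxE hA.
  by rewrite conj_Creal // ger0_real.
by move=> v; rewrite -scalemxAr -scalemxAl mxE mulr_ge0.
Qed.

Lemma psdmx_sum n (I : finType) (F : I -> 'M[C]_n) :
  (forall i, psdmx (F i)) -> psdmx (\sum_i F i).
Proof.
move=> pF; elim/big_ind: _ => //; [exact: psdmx0 | exact: psdmxD].
Qed.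

Lemma psdmx_scalar n (a : C) : 0 <= a -> psdmx (a%:M : 'M[C]_n).
Proof.
move=> a0; rewrite -scalemx1; apply: psdmxZ => //.
have -> : 1%:M = adjmx 1%:M *m (1%:M : 'M[C]_n).
  by rewrite mulmx1; apply/matrixP => i j; rewrite adjmxE !mxE eq_sym conjC_nat.
exact: psdmx_gram.
Qed.

Lemma psdmx_tr n (A : 'M[C]_n) : psdmx A -> psdmx A^T.
Proof.
move=> /psdmx_gramP[K ->].
have -> : (adjmx K *m K)^T = adjmx (map_mx Num.conj K) *m map_mx Num.conj K.
  rewrite trmx_mul; congr (_ *m _); apply/matrixP => i j.
    by rewrite adjmxE !mxE conjCK.
  by rewrite mxE adjmxE mxE.
exact: psdmx_gram.
Qed.

Lemma psdmx_trace_ge0 n (A : 'M[C]_n) : psdmx A -> 0 <= \tr A.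
Proof.
move=> /psdmx_gramP[K ->]; apply: sumr_ge0 => i _; rewrite mxE.
by apply: sumr_ge0 => j _; rewrite adjmxE mulrC mul_conjC_ge0.
Qed.

(** With [A] a Gram matrix, each product in the entry is at most the sum of the two squares, and
    either sum of squares is a diagonal entry. This crude bound serves to bound payoffs and the set
    of Choi matrices. *)
Lemma psdmx_entry_le n (A : 'M[C]_n) i j : psdmx A -> `|A i j| <= \tr A *+ 2.
Proof.
move=> /psdmx_gramP[K ->].
have diag k : (adjmx K *m K) k k = \sum_l `|K l k| ^+ 2.
  by rewrite mxE; apply: eq_bigr => l _; rewrite adjmxE mulrC normCK.
have dtr k : \sum_l `|K l k| ^+ 2 <= \tr (adjmx K *m K).
  rewrite -diag /mxtrace (bigD1 k) //= lerDl; apply: sumr_ge0 => l _.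
  by rewrite diag; apply: sumr_ge0 => m _; rewrite exprn_ge0.
rewrite mulr2n; apply: le_trans (lerD (dtr i) (dtr j)).
rewrite -big_split /= mxE; apply: le_trans (ler_norm_sum _ _ _) _.
apply: ler_sum => l _; rewrite adjmxE normrM norm_conjC.
set a := `|_|; set b := `|_|.
have a0 : 0 <= a by exact: normr_ge0.
have b0 : 0 <= b by exact: normr_ge0.
rewrite -subr_ge0.
have -> : a ^+ 2 + b ^+ 2 - a * b = (a - b) ^+ 2 + a * b.
  by ring.
apply: addr_ge0; last exact: mulr_ge0.
by rewrite real_exprn_even_ge0 // realB ?ger0_real.
Qed.

End PositiveMatrices.

Local Notation ix i j := (mxtens_index (i, j)).

(** * The link product: contraction of a shared tensor factor *)

Section LinkProduct.
Context {R : realType}.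
Local Notation C := R[i].

Lemma sum_ix (V : nmodType) m n (F : 'I_(m * n) -> V) :
  \sum_x F x = \sum_i \sum_j F (ix i j).
Proof.
rewrite pair_bigA (reindex (@mxtens_index m n)) /=.
  by apply: eq_bigr => -[].
by exists (@mxtens_unindex m n) => i _; rewrite ?mxtens_indexK ?mxtens_unindexK.
Qed.

Lemma eq_ix m n (i i' : 'I_m) (j j' : 'I_n) :
  (ix i j == ix i' j') = (i == i') && (j == j').
Proof. by rewrite (can_eq (@mxtens_indexK m n)). Qed.

Lemma tens_matrixP m n (A B : 'M[C]_(m * n)) :
  (forall i j k l, A (ix i j) (ix k l) = B (ix i j) (ix k l)) -> A = B.
Proof.
move=> AB; apply/matrixP => x y.
by case: (mxtens_indexP x) => i j; case: (mxtens_indexP y) => k l.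
Qed.

(* Contraction of the shared middle tensor factor.  On Choi matrices it is the
   composition of maps; on a state and a Choi matrix it applies the map. *)
Definition link {k n p} (P : 'M[C]_(k * n)) (Q : 'M[C]_(n * p)) : 'M[C]_(k * p) :=
  \matrix_(x, y) \sum_(s : 'I_n * 'I_n)
    P (ix (mxtens_unindex x).1 s.1) (ix (mxtens_unindex y).1 s.2)
    * Q (ix s.1 (mxtens_unindex x).2) (ix s.2 (mxtens_unindex y).2).

Lemma linkE k n p (P : 'M[C]_(k * n)) (Q : 'M[C]_(n * p)) a t b u :
  link P Q (ix a t) (ix b u) =
  \sum_(s : 'I_n * 'I_n) P (ix a s.1) (ix b s.2) * Q (ix s.1 t) (ix s.2 u).
Proof. by rewrite mxE !mxtens_indexK. Qed.

Lemma linkA k n p q (P : 'M[C]_(k * n)) (Q : 'M[C]_(n * p)) (S : 'M[C]_(p * q)) :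
  link (link P Q) S = link P (link Q S).
Proof.
apply: tens_matrixP => a t b u; rewrite !linkE.
under eq_bigr do rewrite linkE mulr_suml.
rewrite exchange_big /=; apply: eq_bigr => s _.
by rewrite linkE mulr_sumr; apply: eq_bigr => r _; rewrite mulrA.
Qed.

Lemma trmx_link k n p (P : 'M[C]_(k * n)) (Q : 'M[C]_(n * p)) :
  (link P Q)^T = link P^T Q^T.
Proof.
apply: tens_matrixP => a t b u; rewrite mxE !linkE.
rewrite (reindex_inj (can_inj (@swap_pairK _ _))) /=.
by apply: eq_bigr => s _; rewrite !mxE.
Qed.

Lemma link_sumr k n p (I : finType) (P : 'M[C]_(k * n)) (Q : I -> 'M[C]_(n * p)) :
  link P (\sum_i Q i) = \sum_i link P (Q i).
Proof.
apply: tens_matrixP => a t b u; rewrite summxE linkE.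
under [RHS]eq_bigr do rewrite linkE.
rewrite exchange_big; apply: eq_bigr => s _.
by rewrite summxE mulr_sumr.
Qed.

Lemma linkZr k n p c (P : 'M[C]_(k * n)) (Q : 'M[C]_(n * p)) :
  link P (c *: Q) = c *: link P Q.
Proof.
apply: tens_matrixP => a t b u; rewrite [RHS]mxE !linkE mulr_sumr.
by apply: eq_bigr => s _; rewrite mxE mulrCA.
Qed.

Lemma linkDr k n p (P : 'M[C]_(k * n)) (Q Q' : 'M[C]_(n * p)) :
  link P (Q + Q') = link P Q + link P Q'.
Proof.
apply: tens_matrixP => a t b u; rewrite [RHS]mxE !linkE -big_split /=.
by apply: eq_bigr => s _; rewrite mxE mulrDr.
Qed.

(** Contracting Gram factors of [P] and [Q] over the shared index gives a Gram factor [Z] of the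
    link product: the row and column copies of the shared index are summed independently. *)
Lemma link_psd k n p (P : 'M[C]_(k * n)) (Q : 'M[C]_(n * p)) :
  psdmx P -> psdmx Q -> psdmx (link P Q).
Proof.
move=> /psdmx_gramP[L ->] /psdmx_gramP[K ->].
pose Z : 'M[C]_((k * n) * (n * p), k * p) := \matrix_(x, y)
  \sum_s L (mxtens_unindex x).1 (ix (mxtens_unindex y).1 s)
       * K (mxtens_unindex x).2 (ix s (mxtens_unindex y).2).
suff -> : link (adjmx L *m L) (adjmx K *m K) = adjmx Z *m Z by exact: psdmx_gram.
apply: tens_matrixP => a t b u; rewrite linkE mxE.
transitivity (\sum_(s : 'I_n * 'I_n) \sum_(x : 'I_(k * n) * 'I_(n * p))
   ((L x.1 (ix a s.1) * K x.2 (ix s.1 t))^* *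
    (L x.1 (ix b s.2) * K x.2 (ix s.2 u)))).
  apply: eq_bigr => s _; rewrite !mxE big_distrlr /= pair_bigA /=.
  apply: eq_bigr => x _; rewrite !adjmxE rmorphM /=; ring.
rewrite exchange_big [RHS]sum_ix [RHS]pair_bigA /=; apply: eq_bigr => -[m l] _ /=.
rewrite adjmxE !mxE !mxtens_indexK /= rmorph_sum big_distrlr /= pair_bigA /=.
by apply: eq_bigr.
Qed.

End LinkProduct.

(** * The correspondence between channels and Choi matrices *)

Section Channels.
Context {R : realType}.
Local Notation C := R[i].

(* [psdmx] encodes complete positivity (Choi), the partial trace condition
   encodes trace preservation. *)
Definition choi {nS nT} (G : 'M[C]_(nS * nT)) : Prop :=
  psdmx G /\ forall s s', \sum_t G (ix s t) (ix s' t) = (s == s')%:R.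

(** The inverse Choi correspondence: the partial trace over S of (X^T (x) 1) G. *)
Definition choi_map {nS nT} (G : 'M[C]_(nS * nT)) (X : 'M[C]_nS) : 'M[C]_nT :=
  \matrix_(t, u) \sum_(s : 'I_nS * 'I_nS) X s.1 s.2 * G (ix s.1 t) (ix s.2 u).

Lemma choi_map_is_linear nS nT (G : 'M[C]_(nS * nT)) : linear (choi_map G).
Proof.
move=> c X Y; apply/matrixP => t u; rewrite !mxE mulr_sumr -big_split /=.
by apply: eq_bigr => s _; rewrite !mxE mulrDl mulrA.
Qed.

HB.instance Definition _ nS nT (G : 'M[C]_(nS * nT)) :=
  GRing.isLinear.Build C 'M[C]_nS 'M[C]_nT _ (choi_map G)
    (choi_map_is_linear _ _ G).

Lemma id_tens_choi_map k nS nT (G : 'M[C]_(nS * nT)) (X : 'M[C]_(k * nS)) :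
  id_tens (choi_map G) X = link X G.
Proof.
by apply/matrixP => x y; rewrite !mxE; apply: eq_bigr => s _; rewrite mxE.
Qed.

Lemma choi_map_cp nS nT (G : 'M[C]_(nS * nT)) :
  psdmx G -> completely_positive (choi_map G).
Proof. by move=> pG k X pX; rewrite id_tens_choi_map; exact: link_psd. Qed.

Lemma choi_map_tp nS nT (G : 'M[C]_(nS * nT)) :
  choi G -> trace_preserving (choi_map G).
Proof.
move=> [_ tG] X; rewrite /mxtrace.
transitivity (\sum_s \sum_s' X s s' * \sum_t G (ix s t) (ix s' t)).
  rewrite pair_bigA /=; under eq_bigr do rewrite mxE.
  by rewrite exchange_big; apply: eq_bigr => s _; rewrite mulr_sumr.
apply: eq_bigr => s _; rewrite (bigD1 s) //= tG eqxx mulr1.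
by rewrite big1 ?addr0 // => s' ss'; rewrite tG eq_sym (negPf ss') mulr0.
Qed.

(** Left unnormalised, so that its projector is exactly the Choi matrix of the identity. *)
Definition entangled d : 'rV[C]_(d * d) :=
  \row_x ((mxtens_unindex x).1 == (mxtens_unindex x).2)%:R.

Lemma entangled_gramE d a b a' b' :
  (adjmx (entangled d) *m entangled d) (ix a b) (ix a' b')
  = (a == b)%:R * (a' == b')%:R.
Proof.
by rewrite mxE big_ord1 adjmxE !mxE !mxtens_indexK /= conjC_nat.
Qed.

(** [E] applied to half of the entangled projector stores its values on all matrix units; complete
    positivity makes the result positive, and linearity recovers [E] from it. *)
Lemma channel_choi nS nT (E : {linear 'M[C]_nS -> 'M[C]_nT}) :
  completely_positive E -> trace_preserving E ->
  exists2 G, choi G & forall k (X : 'M[C]_(k * nS)), id_tens E X = link X G.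
Proof.
move=> cpE tpE; pose Om := adjmx (entangled nS) *m entangled nS.
have GE s t s' t' : id_tens E Om (ix s t) (ix s' t') = E (delta_mx s s') t t'.
  rewrite mxE !mxtens_indexK /=; congr (E _ _ _).
  apply/matrixP => x y; rewrite mxE entangled_gramE mxE -natrM mulnb.
  by rewrite [x == s]eq_sym [y == s']eq_sym.
exists (id_tens E Om) => [|k X].
  split; first exact/cpE/psdmx_gram.
  move=> s s'; under eq_bigr do rewrite GE.
  transitivity (\tr (E (delta_mx s s'))); first by [].
  rewrite tpE /mxtrace (bigD1 s) //= mxE eqxx /= big1 ?addr0 // => x xs.
  by rewrite mxE (negPf xs).
apply: tens_matrixP => a t b u; rewrite linkE mxE !mxtens_indexK /=.
rewrite [blockmx _ _ _]matrix_sum_delta pair_bigA linear_sum summxE /=.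
by apply: eq_bigr => s _; rewrite linearZ mxE GE mxE.
Qed.

End Channels.

(** * Payoffs, and pulling strategies back along a channel *)

Section Games.
Context {R : realType}.
Local Notation C := R[i].

(** The operator on N (x) A left after contracting B; [M] enters transposed so that the payoff
    becomes a plain entrywise pairing. *)
Definition env_mx {nN nA nB} (M : 'M[C]_(nN * nB)) (rho : 'M[C]_(nA * nB))
    : 'M[C]_(nN * nA) :=
  \matrix_(x, y) \sum_b \sum_b'
    M (ix (mxtens_unindex y).1 b') (ix (mxtens_unindex x).1 b)
    * rho (ix (mxtens_unindex x).2 b) (ix (mxtens_unindex y).2 b').

Lemma env_mxE nN nA nB (M : 'M[C]_(nN * nB)) (rho : 'M[C]_(nA * nB)) n a n' a' :
  env_mx M rho (ix n a) (ix n' a') =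
  \sum_b \sum_b' M (ix n' b') (ix n b) * rho (ix a b) (ix a' b').
Proof. by rewrite mxE !mxtens_indexK. Qed.

(* The payoff sees the information structure only through [link Phi D^T]. *)
Lemma payoff_term nN nS nA nB (Phi : 'M[C]_(nN * nS)) (rho : 'M[C]_(nA * nB))
    (M : 'M[C]_(nN * nB)) (D : 'M[C]_(nS * nA)) :
  \tr ((Phi *t rho) *m reorder_tens M D) =
  \sum_x \sum_y link Phi D^T x y * env_mx M rho x y.
Proof.
transitivity (\sum_n \sum_s \sum_a \sum_b \sum_n' \sum_s' \sum_a' \sum_b'
  Phi (ix n s) (ix n' s') * rho (ix a b) (ix a' b')
  * (M (ix n' b') (ix n b) * D (ix s' a') (ix s a))).
  rewrite /mxtrace !sum_ix; apply: eq_bigr => n _; apply: eq_bigr => s _.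
  rewrite sum_ix; apply: eq_bigr => a _; apply: eq_bigr => b _.
  rewrite mxE !sum_ix; apply: eq_bigr => n' _; apply: eq_bigr => s' _.
  rewrite sum_ix; apply: eq_bigr => a' _; apply: eq_bigr => b' _.
  by rewrite tensmxE [reorder_tens _ _ _ _]mxE /idx4 !mxtens_indexK.
(* The indices of S and B move inside, where they form [link] and [env_mx] respectively. *)
transitivity (\sum_n \sum_a \sum_n' \sum_a' \sum_s \sum_s' \sum_b \sum_b'
  Phi (ix n s) (ix n' s') * rho (ix a b) (ix a' b')
  * (M (ix n' b') (ix n b) * D (ix s' a') (ix s a))).
  apply: eq_bigr => n _; rewrite exchange_big; apply: eq_bigr => a _ /=.
  under eq_bigr do rewrite exchange_big.
  rewrite exchange_big; apply: eq_bigr => n' _ /=.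
  rewrite [RHS]exchange_big; apply: eq_bigr => s _ /=.
  rewrite exchange_big [RHS]exchange_big; apply: eq_bigr => s' _ /=.
  by rewrite exchange_big.
rewrite sum_ix; apply: eq_bigr => n _; apply: eq_bigr => a _.
rewrite sum_ix; apply: eq_bigr => n' _; apply: eq_bigr => a' _.
rewrite linkE env_mxE mulr_suml pair_bigA; apply: eq_bigr => s _ /=.
rewrite mulr_sumr; apply: eq_bigr => b _.
rewrite mulr_sumr; apply: eq_bigr => b' _; rewrite mxE; ring.
Qed.

(** Linking with [G^T] applies the adjoint of the channel to the first factor of each effect; trace
    preservation of the channel is unitality of its adjoint. *)
Lemma pullback_strategy nS nT nA k (G : 'M[C]_(nS * nT))
    (D : 'I_k -> 'M[C]_(nT * nA)) :
  choi G -> strategy D -> strategy (fun i => link G^T (D i)).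
Proof.
move=> [pG tG] [pD sD]; split => [i|]; first exact/link_psd/pD/psdmx_tr.
rewrite -link_sumr sD; apply: tens_matrixP => s a s' a'.
rewrite linkE mxE eq_ix -(pair_bigA _ (fun t t' =>
  G^T (ix s t) (ix s' t') * 1%:M (ix t a) (ix t' a'))) /=.
transitivity (\sum_t G (ix s' t) (ix s t) * (a == a')%:R).
  apply: eq_bigr => t _; rewrite (bigD1 t) //= big1 ?addr0.
    by rewrite !mxE eq_ix eqxx.
  by move=> t' tt'; rewrite !mxE eq_ix eq_sym (negPf tt') mulr0.
by rewrite -mulr_suml tG eq_sym -natrM mulnb.
Qed.

Lemma payoff_pullback nN nS nT nA nB k (G : 'M[C]_(nS * nT))
    (Phi : 'M[C]_(nN * nS)) (rho : 'M[C]_(nA * nB))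
    (M : 'I_k -> 'M[C]_(nN * nB)) (D : 'I_k -> 'M[C]_(nT * nA)) :
  payoff (link Phi G) rho M D = payoff Phi rho M (fun i => link G^T (D i)).
Proof.
apply: eq_bigr => i _; rewrite !payoff_term.
by rewrite trmx_link trmxK linkA.
Qed.

(** Together with [payoff_bounded], this makes the [sup] in [opt_payoff] a genuine supremum: the set
    of payoffs is nonempty and bounded above. *)
Lemma strategy_exists nS nA k : (0 < k)%N ->
  exists D : 'I_k -> 'M[C]_(nS * nA), strategy D.
Proof.
case: k => // k _; exists (fun i => if i == ord0 then 1%:M else 0); split.
  by move=> i; case: eqP => _; [exact: psdmx_scalar | exact: psdmx0].
by rewrite -big_mkcond big_pred1_eq.
Qed.

(** The effects have nonnegative traces that add up to the trace of the identity, so each of these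
    traces is at most that. *)
Lemma strategy_entry_le nS nA k (D : 'I_k -> 'M[C]_(nS * nA)) i x y :
  strategy D -> `|D i x y| <= \tr (1%:M : 'M[C]_(nS * nA)) *+ 2.
Proof.
move=> [pD <-]; apply: le_trans (psdmx_entry_le _ _ _ _ (pD i)) _.
rewrite lerMn2r raddf_sum (bigD1 i) //= lerDl sumr_ge0 // => j _.
exact: psdmx_trace_ge0.
Qed.

Lemma payoff_bounded nN nS nA nB k (Phi : 'M[C]_(nN * nS))
    (rho : 'M[C]_(nA * nB)) (M : 'I_k -> 'M[C]_(nN * nB)) :
  exists B : R, forall D : 'I_k -> 'M[C]_(nS * nA), strategy D ->
    complex.Re (payoff Phi rho M D) <= B.
Proof.
pose B : C := \sum_i \sum_x \sum_y
  (\sum_(s : 'I_nS * 'I_nS)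
     `|Phi (ix (mxtens_unindex x).1 s.1) (ix (mxtens_unindex y).1 s.2)|
      * (\tr (1%:M : 'M[C]_(nS * nA)) *+ 2)) * `|env_mx (M i) rho x y|.
exists (complex.Re B) => D sD.
have le1 : `|payoff Phi rho M D| <= B.
  apply: le_trans (ler_norm_sum _ _ _) _; apply: ler_sum => i _.
  rewrite payoff_term.
  apply: le_trans (ler_norm_sum _ _ _) _; apply: ler_sum => x _.
  apply: le_trans (ler_norm_sum _ _ _) _; apply: ler_sum => y _.
  rewrite normrM ler_wpM2r // mxE.
  apply: le_trans (ler_norm_sum _ _ _) _; apply: ler_sum => s _.
  by rewrite normrM ler_wpM2l // mxE strategy_entry_le.
have := le_trans (normc_ge_Re _) le1; rewrite lecE => /andP[_ /=].
exact/le_trans/ler_norm.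
Qed.

Lemma choi_better nN nS nT (G : 'M[C]_(nS * nT)) (Phi : 'M[C]_(nN * nS)) :
  choi G -> better Phi (link Phi G).
Proof.
move=> cG nA nB rho k M _ k0 _; rewrite /opt_payoff.
apply: ge_sup.
  have [D sD] := strategy_exists nT nA k k0.
  by exists (complex.Re (payoff (link Phi G) rho M D)); exists D.
move=> _ [D sD <-]; rewrite payoff_pullback; apply: ub_le_sup.
  have [B hB] := payoff_bounded _ _ _ _ _ Phi rho M.
  by exists B => _ [D' sD' <-]; exact: hB.
exists (fun i => link G^T (D i)) => //.
exact: pullback_strategy.
Qed.

End Games.

(** * Orthogonal designs and the teleportation game *)

Section Teleportation.
Context {R : realType}.
Local Notation C := R[i].

(** Real orthogonal matrices whose vectorisations form a tight frame. Summing the squares of all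
    entries over all [i] gives k d, spread over d^2 positions: hence the constant k/d. *)
Definition orthogonal_design {k d} (U : 'I_k -> 'M[C]_d) : Prop :=
  [/\ forall i a t, (U i a t)^* = U i a t,
      forall i, (U i)^T *m U i = 1%:M
    & forall a t a' t', \sum_i U i a t * U i a' t'
        = (k%:R / d%:R) * ((a == a') && (t == t'))%:R].

Lemma sum_signs (I : finType) (t t' : I) :
  \sum_(e : {ffun I -> bool}) (-1) ^+ e t * (-1) ^+ e t'
  = #|{ffun I -> bool}|%:R * (t == t')%:R :> C.
Proof.
case: eqVneq => [<-|tt'].
  under eq_bigr do rewrite -expr2 sqrr_sign.
  by rewrite sumr_const mulr1.
rewrite mulr0; set S := LHS.
suff SN : S = - S.
  by have := mulrn_eq0 S 2; rewrite mulr2n {1}SN addNr eqxx => /esym/eqP.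
(* Flipping the sign at [t] alone permutes the sign functions and negates every term. *)
pose flip (e : {ffun I -> bool}) := [ffun j => e j (+) (j == t)].
have flipK : involutive flip.
  by move=> e; apply/ffunP => j; rewrite !ffunE addbK.
rewrite {1}/S (reindex_inj (inv_inj flipK)) -sumrN; apply: eq_bigr => e _.
by rewrite !ffunE eqxx eq_sym (negPf tt') addbF addbT signrN mulNr.
Qed.

(* Signed cyclic shifts; signs play the role of the usual roots of unity in the
   Weyl operators, at the price of a larger family. *)
Lemma orthogonal_design_exists d :
  exists k, exists2 U : 'I_k -> 'M[C]_d.+1, (0 < k)%N & orthogonal_design U.
Proof.
pose T : finType := ({ffun 'I_d.+1 -> bool} * 'I_d.+1)%type.
pose U (w : T) : 'M[C]_d.+1 :=
  \matrix_(a, t) ((a == t + w.2)%:R * (-1) ^+ w.1 t).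
exists #|T|, (fun i => U (enum_val i)).
  by apply/card_gt0P; exists ([ffun=> false], ord0).
split=> [i a t|i|a t a' t'].
- by rewrite mxE rmorphM /= conjC_nat rmorphXn /= rmorphN1.
- move: (enum_val i) => w; apply/matrixP => t t'.
  rewrite mxE (bigD1 (t + w.2)) //= big1 => [|a at'].
    rewrite !mxE eqxx (inj_eq (addIr _)) addr0.
    case: eqVneq => [<-|_]; last by rewrite mul0r mulr0.
    by rewrite !mul1r -expr2 sqrr_sign.
  by rewrite !mxE (negPf at') !mul0r.
rewrite -(big_enum_val (fun w => U w a t * U w a' t')) /=.
rewrite (eq_bigl xpredT) //.
rewrite -(pair_bigA _ (fun e r => U (e, r) a t * U (e, r) a' t')) /=.
transitivity ((\sum_(e : {ffun 'I_d.+1 -> bool}) (-1) ^+ e t * (-1) ^+ e t')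
  * (\sum_r (a == t + r)%:R * (a' == t' + r)%:R) : C).
  rewrite mulr_suml; apply: eq_bigr => e _; rewrite mulr_sumr.
  by apply: eq_bigr => r _; rewrite !mxE /=; ring.
rewrite sum_signs card_prod card_ord natrM mulfK ?pnatr_eq0 // -mulrA.
(* The signs have forced [t = t']; only the shift by [a - t] then contributes, and it forces
   [a = a']. *)
congr (_ * _); case: eqVneq => [<-|_]; last by rewrite andbF mul0r.
rewrite andbT mul1r (bigD1 (a - t)) //= big1 => [|r rat].
  by rewrite addr0 addrC subrK eqxx mul1r [a' == _]eq_sym.
have -> : (a == t + r) = false; last by rewrite mul0r.
by apply: contraNF rat => /eqP ->; rewrite addrC addKr.
Qed.

(** The Choi matrix of X |-> U^T X U. Without a conjugation it is positive for real [U], the case of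
    a design. *)
Definition twist {m n} (U : 'M[C]_(m, n)) : 'M[C]_(m * n) :=
  \matrix_(x, y) (U (mxtens_unindex x).1 (mxtens_unindex x).2
                  * U (mxtens_unindex y).1 (mxtens_unindex y).2).

Lemma twistE m n (U : 'M[C]_(m, n)) a t b u :
  twist U (ix a t) (ix b u) = U a t * U b u.
Proof. by rewrite mxE !mxtens_indexK. Qed.

Lemma trmx_twist m n (U : 'M[C]_(m, n)) : (twist U)^T = twist U.
Proof. by apply/matrixP => x y; rewrite !mxE mulrC. Qed.

Lemma twist_psd m n (U : 'M[C]_(m, n)) :
  (forall a t, (U a t)^* = U a t) -> psdmx (twist U).
Proof.
move=> rU; pose v : 'rV[C]_(m * n) :=
  \row_x U (mxtens_unindex x).1 (mxtens_unindex x).2.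
suff -> : twist U = adjmx v *m v by exact: psdmx_gram.
by apply/matrixP => x y; rewrite !mxE big_ord1 adjmxE !mxE rU.
Qed.

Lemma link_hermitian k n p (P : 'M[C]_(k * n)) (Q : 'M[C]_(n * p)) :
  Defs.hermitianmx P -> Defs.hermitianmx Q -> Defs.hermitianmx (link P Q).
Proof.
move=> hP hQ; apply: tens_matrixP => a t b u; rewrite adjmxE !linkE rmorph_sum.
rewrite (reindex_inj (can_inj (@swap_pairK _ _))) /=.
by apply: eq_bigr => s _; rewrite rmorphM /= -!adjmxE hP hQ.
Qed.

(** Cyclicity of the trace, moving the conjugation by 1 (x) U from [W] to [X]. *)
Lemma tr_mul_link_twist n m p (X : 'M[C]_(n * m)) (W : 'M[C]_(n * p))
    (U : 'M[C]_(m, p)) :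
  \tr (X *m link W (twist U^T)) = \tr (link X (twist U) *m W).
Proof.
transitivity (\sum_n1 \sum_n2 \sum_a \sum_a' \sum_t \sum_t'
  X (ix n1 a) (ix n2 a') * W (ix n2 t') (ix n1 t) * (U a t * U a' t')).
  rewrite /mxtrace sum_ix; apply: eq_bigr => n1 _.
  rewrite exchange_big; apply: eq_bigr => a _; rewrite mxE sum_ix.
  apply: eq_bigr => n2 _; apply: eq_bigr => a' _.
  rewrite linkE mulr_sumr exchange_big pair_bigA /=.
  by apply: eq_bigr => t _; rewrite twistE !mxE; ring.
rewrite /mxtrace sum_ix; apply: eq_bigr => n1 _.
under [RHS]eq_bigr do rewrite mxE sum_ix.
rewrite [RHS]exchange_big; apply: eq_bigr => n2 _ /=.
under eq_bigr do rewrite exchange_big.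
rewrite exchange_big; apply: eq_bigr => t _ /=.
under eq_bigr do rewrite exchange_big.
rewrite exchange_big; apply: eq_bigr => t' _ /=.
rewrite linkE mulr_suml pair_bigA; apply: eq_bigr => a _ /=.
by rewrite twistE; ring.
Qed.

Definition max_entangled d : 'M[C]_(d * d) :=
  d%:R^-1 *: (adjmx (entangled d) *m entangled d).

Lemma max_entangled_density d : density (max_entangled d.+1).
Proof.
split; first by apply: psdmxZ; [rewrite invr_ge0 ler0n | exact: psdmx_gram].
rewrite linearZ /= /mxtrace sum_ix.
rewrite (eq_bigr (fun=> 1)) => [|a _].
  by rewrite sumr_const card_ord -mulr_natr mul1r mulVf ?pnatr_eq0.
rewrite (bigD1 a) //= entangled_gramE eqxx mulr1 big1 ?addr0 // => b ba.
by rewrite entangled_gramE eq_sym (negPf ba) mul0r.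
Qed.

(** The entangled state merely identifies A with B. *)
Lemma env_max_entangled n d (M : 'M[C]_(n * d)) :
  env_mx M (max_entangled d) = d%:R^-1 *: M^T.
Proof.
apply: tens_matrixP => x a y b; rewrite env_mxE !mxE.
rewrite (bigD1 a) //= (bigD1 b) //= !mxE big_ord1 adjmxE !mxE !mxtens_indexK /=.
rewrite !eqxx conjC_nat !mulr1 mulrC !big1 ?addr0 // => [c ca|c cb].
  rewrite big1 // => e _.
  by rewrite mxE entangled_gramE eq_sym (negPf ca) mul0r !mulr0.
by rewrite mxE entangled_gramE [b == _]eq_sym (negPf cb) !mulr0.
Qed.

(** Each summand is the branch of outcome [i]: the effect [D i], then the correction X |-> U_i^T X
    U_i. The prefactor normalises the entangled state. *)
Definition twirl {nS d k} (U : 'I_k -> 'M[C]_d) (D : 'I_k -> 'M[C]_(nS * d))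
    : 'M[C]_(nS * d) :=
  d%:R^-1 *: \sum_i link (D i)^T (twist (U i)).

(* Measuring [D] on [S] and half of the entangled state, then undoing [U i],
   is a channel; the game with payoffs [U i] W [U i]^T tests its output with W. *)
Lemma teleportation_payoff nN nS d k (U : 'I_k -> 'M[C]_d)
    (Phi : 'M[C]_(nN * nS)) (W : 'M[C]_(nN * d)) (D : 'I_k -> 'M[C]_(nS * d)) :
  payoff Phi (max_entangled d) (fun i => link W (twist (U i)^T)) D
  = \tr (link Phi (twirl U D) *m W).
Proof.
rewrite linkZr link_sumr -scalemxAl mulmx_suml linearZ /= raddf_sum mulr_sumr.
apply: eq_bigr => i _; rewrite payoff_term env_max_entangled.
rewrite /= -linkA -tr_mul_link_twist /mxtrace mulr_sumr; apply: eq_bigr => x _.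
rewrite [in RHS]mxE mulr_sumr; apply: eq_bigr => y _.
by rewrite [X in _ * X = _]mxE [X in _ * (_ * X) = _]mxE mulrCA.
Qed.

(** Orthogonality of [U i] makes each correction trace preserving, so the output trace only sees the
    sum of the effects, which is the identity. *)
Lemma twirl_choi nS d k (U : 'I_k -> 'M[C]_d.+1) (D : 'I_k -> 'M[C]_(nS * d.+1)) :
  orthogonal_design U -> strategy D -> choi (twirl U D).
Proof.
move=> [rU oU _] [pD sD]; split.
  apply: psdmxZ; first by rewrite invr_ge0 ler0n.
  by apply: psdmx_sum => i; apply: link_psd; [exact: psdmx_tr | exact: twist_psd].
move=> s s'.
have UU i a b : \sum_t U i a t * U i b t = (a == b)%:R.
  have /matrixP/(_ a b) := mulmx1C (oU i); rewrite !mxE => <-.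
  by apply: eq_bigr => t _; rewrite mxE.
transitivity (d.+1%:R^-1 * \sum_a (\sum_i D i) (ix s' a) (ix s a)).
  under eq_bigr do rewrite mxE summxE.
  rewrite -mulr_sumr; congr (_ * _); rewrite exchange_big /=.
  under [RHS]eq_bigr do rewrite summxE.
  rewrite [RHS]exchange_big /=; apply: eq_bigr => i _.
  under eq_bigr do rewrite linkE.
  rewrite exchange_big -(pair_bigA _ (fun a b => \sum_t
    (D i)^T (ix s a) (ix s' b) * twist (U i) (ix a t) (ix b t))) /=.
  apply: eq_bigr => a _; rewrite (bigD1 a) //= [X in _ + X]big1 ?addr0 => [|b ba].
    under eq_bigr do rewrite twistE.
    by rewrite -mulr_sumr UU eqxx mulr1 mxE.
  under eq_bigr do rewrite twistE.
  by rewrite -mulr_sumr UU eq_sym (negPf ba) mulr0.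
rewrite sD; under eq_bigr do rewrite mxE eq_ix eqxx andbT.
by rewrite sumr_const card_ord -[X in _ * X]mulr_natl mulKf ?pnatr_eq0 // eq_sym.
Qed.

Lemma link_entangled n d (X : 'M[C]_(n * d)) :
  link X (adjmx (entangled d) *m entangled d) = X.
Proof.
apply: tens_matrixP => a t b u; rewrite linkE (bigD1 (t, u)) //= big1 => [|s].
  by rewrite entangled_gramE !eqxx !mulr1 addr0.
rewrite entangled_gramE -pair_eqE /= negb_and => /orP[] /negPf ->.
  by rewrite mul0r mulr0.
by rewrite !mulr0.
Qed.

Lemma link_twist_tr d (U : 'M[C]_d) : U^T *m U = 1%:M ->
  link (twist U^T) (twist U) = adjmx (entangled d) *m entangled d.
Proof.
move=> oU; have UU s t : \sum_a U a s * U a t = (s == t)%:R.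
  have /matrixP/(_ s t) := oU; rewrite !mxE => <-.
  by apply: eq_bigr => a _; rewrite mxE.
apply: tens_matrixP => s t s' t'; rewrite linkE entangled_gramE -!UU.
rewrite big_distrlr pair_bigA /=; apply: eq_bigr => a _.
by rewrite !twistE !mxE; ring.
Qed.

Lemma teleportation_strategy d k (U : 'I_k -> 'M[C]_d.+1) :
  (0 < k)%N -> orthogonal_design U ->
  exists2 D : 'I_k -> 'M[C]_(d.+1 * d.+1), strategy D &
    forall n (Psi : 'M[C]_(n * d.+1)), link Psi (twirl U D) = Psi.
Proof.
move=> k0 [rU oU sU]; pose c : C := d.+1%:R / k%:R.
have kn0 : k%:R != 0 :> C by rewrite pnatr_eq0 -lt0n.
have dn0 : d.+1%:R != 0 :> C by rewrite pnatr_eq0.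
(* The generalised Bell measurement; [c] inverts the constant of the design, so the effects sum to
   the identity. *)
exists (fun i => c *: twist (U i)^T).
  split=> [i|].
    apply: psdmxZ; first by rewrite divr_ge0 ?ler0n.
    by apply: twist_psd => a t; rewrite mxE rU.
  rewrite -scaler_sumr; apply: tens_matrixP => s a s' a'.
  rewrite !mxE summxE eq_ix.
  under eq_bigr do rewrite twistE !mxE.
  by rewrite sU andbC /c; field; rewrite kn0 nat1r dn0.
move=> n Psi; rewrite -[RHS]link_entangled; congr (link _ _).
(* Every outcome contributes the same multiple of the identity channel, since the correction cancels
   the rotation by [U i]. *)
rewrite /twirl (eq_bigr (fun=> c *: (adjmx (entangled d.+1) *m entangled d.+1))).
  rewrite sumr_const card_ord -[X in _ *: X]scaler_nat !scalerA /c.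
  rewrite [_ * (_ * _)](_ : _ = 1) ?scale1r //.
  by field; rewrite kn0 nat1r dn0.
move=> i _; rewrite linearZ /= trmx_twist -(link_twist_tr _ (U i)) //.
apply: tens_matrixP => x y x' y'; rewrite [RHS]mxE !linkE mulr_sumr.
by apply: eq_bigr => s _; rewrite mxE mulrA.
Qed.

End Teleportation.

(** * Compactness of the set of channels and a closest one *)

Section Compactness.
Context {R : realType}.
Local Notation C := R[i].
Local Open Scope classical_set_scope.

Lemma ReD (x y : C) : complex.Re (x + y) = complex.Re x + complex.Re y.
Proof. by case: x; case: y. Qed.

Lemma ReMr (t : R) (x : C) : complex.Re (t%:C%C * x) = t * complex.Re x.
Proof. by case: x => a b /=; rewrite mul0r subr0. Qed.

(* Continuity of complex-valued maps is only needed componentwise, which avoids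
   equipping [R[i]] with a topology. *)
Definition ccontinuous {V : topologicalType} (g : V -> C) : Prop :=
  continuous (fun x => complex.Re (g x)) /\ continuous (fun x => complex.Im (g x)).

Section Ccontinuous.
Context {V : topologicalType}.
Implicit Types f g : V -> C.

Lemma ccontinuous_cst (c : C) : ccontinuous (fun _ : V => c).
Proof. by split=> x; exact: cvg_cst. Qed.

Lemma ccontinuousD f g :
  ccontinuous f -> ccontinuous g -> ccontinuous (fun x => f x + g x).
Proof.
move=> [rf jf] [rg jg]; split.
  rewrite (_ : (fun _ => _) = (fun x => complex.Re (f x) + complex.Re (g x))).
    by move=> x; apply: cvgD; [exact: rf | exact: rg].
  by apply/funext => x; case: (f x); case: (g x).
rewrite (_ : (fun _ => _) = (fun x => complex.Im (f x) + complex.Im (g x))).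
  by move=> x; apply: cvgD; [exact: jf | exact: jg].
by apply/funext => x; case: (f x); case: (g x).
Qed.

Lemma ccontinuousM f g :
  ccontinuous f -> ccontinuous g -> ccontinuous (fun x => f x * g x).
Proof.
move=> [rf jf] [rg jg]; split.
  rewrite (_ : (fun _ => _) = (fun x => complex.Re (f x) * complex.Re (g x)
                                   - complex.Im (f x) * complex.Im (g x))).
    move=> x; apply: cvgB; apply: cvgM;
      [exact: rf | exact: rg | exact: jf | exact: jg].
  by apply/funext => x; case: (f x); case: (g x).
rewrite (_ : (fun _ => _) = (fun x => complex.Re (f x) * complex.Im (g x)
                                 + complex.Im (f x) * complex.Re (g x))).
  move=> x; apply: cvgD; apply: cvgM;
    [exact: rf | exact: jg | exact: jf | exact: rg].
by apply/funext => x; case: (f x); case: (g x).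
Qed.

Lemma ccontinuous_conj f : ccontinuous f -> ccontinuous (fun x => (f x)^*).
Proof.
move=> [rf jf]; split.
  rewrite (_ : (fun _ => _) = (fun x => complex.Re (f x))) //.
  by apply/funext => x; case: (f x).
rewrite (_ : (fun _ => _) = (fun x => - complex.Im (f x))).
  by move=> x; apply: cvgN; exact: jf.
by apply/funext => x; case: (f x).
Qed.

Lemma ccontinuousN f : ccontinuous f -> ccontinuous (fun x => - f x).
Proof.
move=> cf; rewrite (_ : (fun _ => _) = (fun x => -1 * f x)).
  by apply: ccontinuousM => //; exact: ccontinuous_cst.
by apply/funext => x; rewrite mulN1r.
Qed.

Lemma ccontinuous_sum (I : finType) (F : I -> V -> C) :
  (forall i, ccontinuous (F i)) -> ccontinuous (fun x => \sum_i F i x).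
Proof.
move=> cF; elim: (index_enum I) => [|i s IH].
  rewrite (_ : (fun _ => _) = (fun=> 0)); first exact: ccontinuous_cst.
  by apply/funext => x; rewrite big_nil.
rewrite (_ : (fun _ => _) = (fun x => F i x + \sum_(j <- s) F j x)).
  exact: ccontinuousD.
by apply/funext => x; rewrite big_cons.
Qed.

Lemma closed_ccontinuous_eq f c : ccontinuous f -> closed [set x | f x = c].
Proof.
move=> [rf jf].
rewrite (_ : [set _ | _] =
  (fun x => complex.Re (f x)) @^-1` [set complex.Re c]
  `&` (fun x => complex.Im (f x)) @^-1` [set complex.Im c]).
  apply: closedI; first by apply: ((continuous_closedP _).1 rf); exact: closed_eq.
  by apply: ((continuous_closedP _).1 jf); exact: closed_eq.
apply/seteqP; split=> x /=; first by move=> ->.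
by case: (f x) => a b; case: c => a' b' /= [-> ->].
Qed.

Lemma closed_ccontinuous_ge0 f : ccontinuous f -> closed [set x | 0 <= f x].
Proof.
move=> [rf jf].
rewrite (_ : [set _ | _] =
  (fun x => complex.Re (f x)) @^-1` [set y | 0 <= y]
  `&` (fun x => complex.Im (f x)) @^-1` [set 0]).
  apply: closedI; first by apply: ((continuous_closedP _).1 rf); exact: closed_ge.
  by apply: ((continuous_closedP _).1 jf); exact: closed_eq.
apply/seteqP; split=> x /=; rewrite lecE /=.
  by move=> /andP[/eqP -> ->].
by move=> [-> ->]; rewrite eqxx.
Qed.

End Ccontinuous.

(** Real coordinates, real parts before imaginary parts, in which closed subsets of boxes are
    compact. *)
Definition cmx {m} (x : 'rV[R]_(m * m + m * m)) : 'M[C]_m :=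
  \matrix_(i, j) (x 0 (lshift (m * m) (mxvec_index i j))
                  +i* x 0 (rshift (m * m) (mxvec_index i j)))%C.

Definition rvec {m} (A : 'M[C]_m) : 'rV[R]_(m * m + m * m) :=
  row_mx (mxvec (map_mx (@complex.Re R) A)) (mxvec (map_mx (@complex.Im R) A)).

Lemma rvecK m : cancel (@rvec m) cmx.
Proof.
move=> A; apply/matrixP => i j; rewrite mxE row_mxEl row_mxEr !mxvecE !mxE.
by case: (A i j).
Qed.

Lemma ccontinuous_cmx m (i j : 'I_m) :
  ccontinuous (fun x : 'rV[R]_(m * m + m * m) => cmx x i j).
Proof.
split.
  rewrite (_ : (fun _ => _) = (fun x : 'rV[R]_(m * m + m * m) =>
    x 0 (lshift (m * m) (mxvec_index i j)))); first exact: coord_continuous.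
  by apply/funext => x; rewrite mxE.
rewrite (_ : (fun _ => _) = (fun x : 'rV[R]_(m * m + m * m) =>
  x 0 (rshift (m * m) (mxvec_index i j)))); first exact: coord_continuous.
by apply/funext => x; rewrite mxE.
Qed.

Lemma closed_psd m : closed [set x : 'rV[R]_(m * m + m * m) | psdmx (cmx x)].
Proof.
(* Positivity is an intersection of closed conditions: one equation per entry and one inequality per
   vector. *)
rewrite (_ : [set _ | _] =
  \bigcap_(p in [set: 'I_m * 'I_m])
    [set x | adjmx (cmx x) p.1 p.2 - cmx x p.1 p.2 = 0]
  `&` \bigcap_(v in [set: 'rV[C]_m]) [set x | 0 <= (v *m cmx x *m adjmx v) 0 0]).
  apply: closedI; apply: closed_bigI => p _.
    apply: closed_ccontinuous_eq; apply: ccontinuousD.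
      rewrite (_ : (fun _ => _) = (fun x => (cmx x p.2 p.1)^*)).
        exact/ccontinuous_conj/ccontinuous_cmx.
      by apply/funext => x; rewrite adjmxE.
    exact/ccontinuousN/ccontinuous_cmx.
  apply: closed_ccontinuous_ge0.
  rewrite (_ : (fun _ => _) = (fun x =>
    \sum_j (\sum_i p 0 i * cmx x i j) * adjmx p j 0)).
    apply: ccontinuous_sum => j; apply: ccontinuousM; last exact: ccontinuous_cst.
    apply: ccontinuous_sum => i; apply: ccontinuousM; first exact: ccontinuous_cst.
    exact: ccontinuous_cmx.
  by apply/funext => x; rewrite mxE; apply: eq_bigr => j _; rewrite mxE.
apply/seteqP; split=> x /=.
  by move=> [hx px]; split=> p _ //=; rewrite hx subrr.
move=> [hx px]; split; last by move=> v; exact: px.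
by apply/matrixP => i j; apply/eqP; rewrite -subr_eq0; apply/eqP/(hx (i, j)).
Qed.

Lemma choi_trace nS nT (G : 'M[C]_(nS * nT)) : choi G -> \tr G = nS%:R.
Proof.
move=> [_ tG]; rewrite /mxtrace sum_ix.
under eq_bigr do rewrite tG eqxx.
by rewrite sumr_const card_ord.
Qed.

Lemma ler_abs_Im (z : C) : (`|complex.Im z|)%:C%C <= `|z|.
Proof.
have -> : `|z| = `|z * 'i%C|.
  rewrite normrM [X in _ * X](_ : _ = 1) ?mulr1 //.
  by rewrite normc_def /= expr0n /= add0r expr1n sqrtr1.
by rewrite -normrN -ReiNIm; exact: normc_ge_Re.
Qed.

Lemma compact_choi nS nT :
  compact [set x : 'rV[R]_((nS * nT) * (nS * nT) + (nS * nT) * (nS * nT))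
          | choi (cmx x)].
Proof.
(* Every Choi matrix has trace [nS], and [psdmx_entry_le] doubles it. *)
pose B : R := nS%:R *+ 2.
apply: (@subclosed_compact _ _
  [set x : 'rV[R]__ | forall i, [set` `[- B, B]%R] (x ord0 i)]).
- rewrite (_ : [set _ | _] = [set x | psdmx (cmx x)] `&`
    \bigcap_(p in [set: 'I_nS * 'I_nS])
     [set x | \sum_t cmx x (ix p.1 t) (ix p.2 t) = (p.1 == p.2)%:R]).
    apply: closedI; first exact: closed_psd.
    apply: closed_bigI => p _; apply: closed_ccontinuous_eq.
    by apply: ccontinuous_sum => t; exact: ccontinuous_cmx.
  apply/seteqP; split=> x /= [px tx]; split=> //; first by move=> p _; exact: tx.
  by move=> s s'; exact: (tx (s, s')).
- apply: (@rV_compact _ _ (fun=> [set` `[- B, B]%R])) => i.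
  exact: segment_compact.
move=> x /= cx i; rewrite in_itv /= -ler_norml -lecR.
have eB : B%:C%C = \tr (cmx x) *+ 2.
  by rewrite choi_trace // /B !rmorphMn rmorph1.
rewrite eB; have [px _] := cx.
case: (split_ordP i) => j -> {i}; case/mxvec_indexP: j => a b;
  apply: le_trans (psdmx_entry_le _ _ a b px).
  by apply: le_trans (normc_ge_Re _); rewrite mxE.
by apply: le_trans (ler_abs_Im _); rewrite mxE.
Qed.

Lemma choi_exists nS nT : (0 < nT)%N -> exists G : 'M[C]_(nS * nT), choi G.
Proof.
(* The completely depolarising channel. *)
move=> nT0; exists (nT%:R^-1)%:M; split.
  by apply: psdmx_scalar; rewrite invr_ge0 ler0n.
move=> s s'; under eq_bigr do rewrite mxE eq_ix eqxx andbT.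
rewrite sumr_const card_ord; case: eqP => _; last by rewrite mul0rn.
by rewrite mulr1n -[LHS]mulr_natr mulVf // pnatr_eq0 -lt0n.
Qed.

Definition sqnorm {n} (X : 'M[C]_n) : R := complex.Re (\tr (X *m adjmx X)).

Lemma sqnorm_le0 n (X : 'M[C]_n) : sqnorm X <= 0 -> X = 0.
Proof.
have tE : \tr (X *m adjmx X) = \sum_i \sum_j `|X i j| ^+ 2.
  apply: eq_bigr => i _; rewrite mxE; apply: eq_bigr => j _.
  by rewrite adjmxE normCK.
have t0 : 0 <= \tr (X *m adjmx X).
  by rewrite tE; do 2!apply: sumr_ge0 => ? _; rewrite exprn_ge0.
rewrite /sqnorm => le0; have : \tr (X *m adjmx X) = 0.
  by apply/eqP; rewrite eq_le t0 andbT lecE (ger0_Im t0) eqxx.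
rewrite tE => /eqP; rewrite psumr_eq0 => [|i _]; last first.
  by apply: sumr_ge0 => j _; rewrite exprn_ge0.
move=> /allP s0; apply/matrixP => i j; rewrite mxE.
have := s0 i (mem_index_enum _); rewrite psumr_eq0 /= => [|l _]; last first.
  by rewrite exprn_ge0.
move=> /allP/(_ j (mem_index_enum _)) /=.
by rewrite sqrf_eq0 normr_eq0 => /eqP.
Qed.

Lemma closest_choi nN nS nT (Phi : 'M[C]_(nN * nS)) (Psi : 'M[C]_(nN * nT)) :
  (0 < nT)%N -> exists2 G : 'M[C]_(nS * nT), choi G &
    forall G', choi G' -> sqnorm (Psi - link Phi G) <= sqnorm (Psi - link Phi G').
Proof.
move=> nT0.
have [|x|x /set_mem /= cx mx] := @EVT_min_rV R _
  (fun x => sqnorm (Psi - link Phi (cmx x))) _ _ (compact_choi nS nT).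
- by have [G cG] := choi_exists nS nT nT0; exists (rvec G); rewrite /= rvecK.
- apply: continuous_subspaceT => {}x.
  have cX i j : ccontinuous
      (fun x : 'rV[R]_((nS * nT) * (nS * nT) + (nS * nT) * (nS * nT)) =>
       (Psi - link Phi (cmx x)) i j).
    rewrite (_ : (fun _ => _) = (fun x => Psi i j - link Phi (cmx x) i j)).
      apply: ccontinuousD; first exact: ccontinuous_cst.
      apply: ccontinuousN.
      case: (mxtens_indexP i) => a t; case: (mxtens_indexP j) => b u.
      rewrite (_ : (fun _ => _) = (fun x => \sum_(s : 'I_nS * 'I_nS)
        Phi (ix a s.1) (ix b s.2) * cmx x (ix s.1 t) (ix s.2 u))).
        apply: ccontinuous_sum => s; apply: ccontinuousM.
          exact: ccontinuous_cst.
        exact: ccontinuous_cmx.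
      by apply/funext => y; rewrite linkE.
    by apply/funext => y; rewrite !mxE.
  suff [+ _] : ccontinuous
      (fun x : 'rV[R]_((nS * nT) * (nS * nT) + (nS * nT) * (nS * nT))
      => \tr ((Psi - link Phi (cmx x)) *m adjmx (Psi - link Phi (cmx x)))).
    by apply.
  rewrite (_ : (fun _ => _) = (fun x => \sum_i \sum_j
    (Psi - link Phi (cmx x)) i j * ((Psi - link Phi (cmx x)) i j)^*)).
    apply: ccontinuous_sum => i; apply: ccontinuous_sum => j.
    by apply: ccontinuousM => //; exact: ccontinuous_conj.
  apply/funext => y; apply: eq_bigr => i _; rewrite mxE.
  by apply: eq_bigr => j _; rewrite adjmxE.
exists (cmx x) => // G' cG'; rewrite -[G']rvecK; apply: mx.
by rewrite inE /= rvecK.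
Qed.

End Compactness.

(** * First-order optimality and the equivalence *)

Section Main.
Context {R : realType}.
Local Notation C := R[i].
Local Notation Re := (@complex.Re R).

Lemma hermitian_density n (A : 'M[C]_n) : density A -> Defs.hermitianmx A.
Proof. by case=> -[]. Qed.

Lemma choi_hermitian nS nT (G : 'M[C]_(nS * nT)) : choi G -> Defs.hermitianmx G.
Proof. by case=> -[]. Qed.

Lemma hermitianB n (A B : 'M[C]_n) :
  Defs.hermitianmx A -> Defs.hermitianmx B -> Defs.hermitianmx (A - B).
Proof.
move=> hA hB; apply/matrixP => i j; rewrite adjmxE !mxE rmorphB /= -!adjmxE.
by rewrite hA hB.
Qed.

Lemma hermitian_scale_real n (t : R) (A : 'M[C]_n) :
  Defs.hermitianmx A -> Defs.hermitianmx (t%:C%C *: A).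
Proof.
move=> hA; apply/matrixP => i j; rewrite adjmxE !mxE rmorphM /= -adjmxE hA.
by congr (_ * _); exact: conjc_real.
Qed.

Lemma choi_convex nS nT (G G' : 'M[C]_(nS * nT)) (t : R) :
  choi G -> choi G' -> 0 <= t <= 1 ->
  choi (G + t%:C%C *: (G' - G)).
Proof.
move=> [pG tG] [pG' tG'] /andP[t0 t1].
have -> : G + t%:C%C *: (G' - G) = (1 - t)%:C%C *: G + t%:C%C *: G'.
  by rewrite rmorphB rmorph1 scalerBl scale1r scalerBr addrA addrAC.
split.
  by apply: psdmxD; apply: psdmxZ => //; rewrite ler0c // subr_ge0.
move=> s s'; under eq_bigr do rewrite mxE [X in X + _]mxE [X in _ + X]mxE.
rewrite big_split /= -!mulr_sumr tG tG' -mulrDl -rmorphD /= subrK.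
by rewrite rmorph1 mul1r.
Qed.

(** A minimum over the segment at its endpoint 0 forces the slope -2b there to be nonnegative. *)
Lemma quadratic_slope (a b c : R) :
  (forall t, 0 <= t <= 1 -> a <= a - t * b *+ 2 + t ^+ 2 * c) -> b <= 0.
Proof.
move=> H; rewrite leNgt; apply/negP => b0.
have cb : 0 < b + `|c| by rewrite ltr_pwDl.
(* Chosen so that [t <= 1] and t |c| = b - t b < b, whereas the hypothesis at [t] gives t c >=
   2b. *)
pose t := b / (b + `|c|).
have t0 : 0 < t by rewrite divr_gt0.
have tc : t * (b + `|c|) = b by rewrite /t divfK // gt_eqF.
have t1 : t <= 1 by rewrite ler_pdivrMr // mul1r lerDl.
have := H t; rewrite (ltW t0) t1 => /(_ isT).
rewrite -subr_ge0 (_ : _ - a = t * (t * c - b *+ 2)); last by ring.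
rewrite pmulr_rge0 // subr_ge0 mulr2n => le2.
have : t * c <= t * `|c| by rewrite ler_pM2l // ler_norm.
have : 0 < t * b by rewrite mulr_gt0.
move: tc; rewrite mulrDr; lra.
Qed.

(* First-order optimality: [W] is an outer normal at the closest point. *)
Lemma closest_choi_normal nN nS nT (Phi : 'M[C]_(nN * nS)) (Psi : 'M[C]_(nN * nT))
    (G G' : 'M[C]_(nS * nT)) :
  density Phi -> density Psi -> choi G -> choi G' ->
  (forall G', choi G' -> sqnorm (Psi - link Phi G) <= sqnorm (Psi - link Phi G')) ->
  Re (\tr (link Phi G' *m (Psi - link Phi G)))
  <= Re (\tr (link Phi G *m (Psi - link Phi G))).
Proof.
move=> /hermitian_density hPhi /hermitian_density hPsi cG cG' minG.
have hG := choi_hermitian _ _ _ cG; have hG' := choi_hermitian _ _ _ cG'.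
set W := Psi - _; pose Delta := link Phi (G' - G).
have hW : adjmx W = W by apply: hermitianB => //; exact: link_hermitian.
have hD : adjmx Delta = Delta.
  by apply: link_hermitian => //; exact: hermitianB.
suff : Re (\tr (Delta *m W)) <= 0.
  have -> : link Phi G' = link Phi G + Delta.
    by rewrite -linkDr addrC subrK.
  by rewrite mulmxDl mxtraceD ReD gerDl.
(* Along the segment from [G] to [G'] the squared distance is the square norm of [W - t Delta], a
   quadratic in [t]. *)
apply: (@quadratic_slope (sqnorm W) _ (sqnorm Delta)) => t t01.
apply: le_trans (minG _ (choi_convex _ _ _ _ t cG cG' t01)) _.
rewrite linkDr linkZr opprD addrA -/W -/Delta /sqnorm hW hD.
clearbody W Delta.
have -> : adjmx (W - t%:C%C *: Delta) = W - t%:C%C *: Delta.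
  by apply: hermitianB => //; exact: hermitian_scale_real.
rewrite mulmxBl !mulmxBr -!scalemxAl -!scalemxAr !linearB !linearZ /=.
rewrite (mxtrace_mulC W Delta).
have RN (x : C) : Re (- x) = - Re x by case: x.
rewrite !(ReD, RN, ReMr).
rewrite le_eqVlt; apply/orP; left; apply/eqP; ring.
Qed.

Lemma better_choi nN nS nT (Phi : 'M[C]_(nN * nS)) (Psi : 'M[C]_(nN * nT)) :
  density Phi -> density Psi -> better Phi Psi ->
  exists2 G, choi G & Psi = link Phi G.
Proof.
move=> dPhi dPsi bet.
have nT0 : (0 < nT)%N.
  rewrite lt0n; apply/eqP => nT0; subst nT; case: dPsi => _.
  rewrite /mxtrace sum_ix big1 => [/eqP|n _]; last by rewrite big_ord0.
  by rewrite eq_sym oner_eq0.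
have [G cG minG] := closest_choi _ _ _ Phi Psi nT0; exists G => //.
pose W := Psi - link Phi G.
have hW : Defs.hermitianmx W.
  apply: hermitianB; first exact: hermitian_density.
  by apply: link_hermitian; [exact: hermitian_density | exact: choi_hermitian].
apply/eqP; rewrite -subr_eq0 -/W; apply/eqP/sqnorm_le0.
(* As [W] is Hermitian, its square norm is tr(Psi W) - tr(link Phi G W). *)
rewrite /sqnorm hW {1}/W mulmxBl linearB /=.
rewrite (_ : forall x y : C, Re (x - y) = Re x - Re y) ?subr_le0; last first.
  by move=> [? ?] [? ?].
case: nT nT0 Psi G dPsi bet cG minG @W hW => // d _ Psi G dPsi bet cG minG W hW.
have [k [U k0 oU]] := @orthogonal_design_exists R d.
have [D sD telD] := teleportation_strategy _ _ U k0 oU.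
pose M i := link W (twist (U i)^T).
have hM i : Defs.hermitianmx (M i).
  apply: link_hermitian => //; case: oU => rU _ _.
  by have [] : psdmx (twist (U i)^T) by apply: twist_psd => a t; rewrite mxE.
have := bet _ _ (max_entangled d.+1) _ M (max_entangled_density d) k0 hM.
(* tr(Psi W) is the payoff of perfect teleportation, hence at most the optimum for [Psi]. *)
move=> le_opt; rewrite -[in X in X <= _](telD _ Psi) -teleportation_payoff.
apply: (@le_trans _ _ (opt_payoff Psi (max_entangled d.+1) M)).
  apply: ub_le_sup; last by exists D.
  have [B hB] := payoff_bounded _ _ _ _ _ Psi (max_entangled d.+1) M.
  by exists B => _ [D' sD' <-]; exact: hB.
apply: le_trans le_opt _; apply: ge_sup.
  have [D' sD'] := @strategy_exists R nS d.+1 k k0.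
  by exists (Re (payoff Phi (max_entangled d.+1) M D')); exists D'.
(* Any strategy for [Phi] tests the output of some channel against [W], and none beats [G]. *)
move=> _ [D' sD' <-]; rewrite teleportation_payoff.
by apply: closest_choi_normal => //; exact: twirl_choi.
Qed.

End Main.

Theorem theorem2 (R : realType) (nN nS nT : nat)
  (Phi : 'M[R[i]]_(nN * nS)) (Psi : 'M[R[i]]_(nN * nT)) :
  density Phi -> density Psi ->
  (better Phi Psi <->
   exists E : {linear 'M[R[i]]_nS -> 'M[R[i]]_nT},
     completely_positive E /\ trace_preserving E /\ Psi = id_tens E Phi).
Proof.
move=> dPhi dPsi; split.
  move=> /(better_choi _ _ _ _ _ dPhi dPsi)[G cG ->]; exists (choi_map G).
  split; first by apply: choi_map_cp; case: cG.
  by split; [exact: choi_map_tp | rewrite id_tens_choi_map].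
move=> [E [cpE [tpE ->]]]; have [G cG ->] := channel_choi _ _ _ cpE tpE.
exact: choi_better.
Qed.
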